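(* For any $n,m,r\in \mathbb{Z}^{+}$, there are infinitely many $a\in \mathcal{A}_n$ with $a\equiv r\pmod{m}$, where $\mathcal{A}_n=\{\pi(kn):\ k\in\mathbb{Z}^+\}$.
   Context: $\mathbb{Z}^+=\{1,2,3,\ldots\}$. For $x\ge 0$, $\pi(x)$ denotes the number of primes not exceeding $x$. *)

(* Defs.v *)
From mathcomp Require Import all_boot.
From mathcomp Require Import boolp classical_sets cardinality.
Set Implicit Arguments.
Unset Strict Implicit.
Unset Printing Implicit Defensive.

Local Open Scope classical_set_scope.

(* Restricted to natural arguments, the only ones occurring in [calA]. *)
Definition primepi (x : nat) : nat := #|[set p : 'I_x.+1 | prime p]%SET|.

Definition calA (n : nat) : set nat :=
  [set primepi (k * n) | k in [set k : nat | 0 < k]].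

(* Main.v *)
Require Import Defs.
From mathcomp Require Import all_boot.
From mathcomp Require Import boolp classical_sets cardinality.
From mathcomp Require Import all_order all_algebra zify ring lra.
Set Implicit Arguments.
Unset Strict Implicit.
Unset Printing Implicit Defensive.
Import Order.TTheory GRing.Theory Num.Theory.

(** The values of [primepi] at multiples of [n] miss an index [i] only if no
    multiple of [n] lies between the [i]-th prime and the next one, and then the
    [i]-th prime [p] has another prime [p + h] with [0 < h < n]. If only
    finitely many elements of [calA n] were congruent to [r] modulo [m], this
    would happen for all but finitely many [i] congruent to [r], that is, for a
    proportion about [1 / m] of all primes. But prime pairs at bounded distance
    have density zero among the primes: up to [x] there are
    [O(x / log(x)^2)] of them, by an upper-bound sieve, against at least
    [c x / log x] primes, by Chebyshev.

    The Chebyshev bound [primepi_lower] comes from [2^N <= 'C(2N, N)], as every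
    prime power in the binomial coefficient is at most [2N].

    The sieve [sieve_bound] is the dual form of Selberg's. For a prime [p > h]
    let [psi h p] be the function of [N mod p] that equals [1] when [p] does not
    divide [N (N + h)], is constant on the two remaining classes and has mean
    zero. Products of the [psi h p] over
    the prime factors of distinct squarefree [d] are orthogonal on a period, by
    the Chinese remainder theorem ([wpsi_orthogonal]). The sum [F N] of these
    products over [d < D], with weights [wtn d], has mean square about
    [G], the sum of the weights, while [F N = G] whenever [N (N + h)] has
    no prime factor in the sieving range. So at most about [x / G] of the [N < x]
    survive.

    It remains to see that [G] has order [log(D)^2]. Since [wtn d] is at least
    [2^omega(d) / d] and [2^omega(d)] counts the factorizations [d = a b] of a
    squarefree [d], [G] dominates the sum of [1 / (a b)] over pairs with [a b]
    squarefree. Sieving only by primes above a bound [y >= 6] makes pairs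
    with a repeated prime contribute at most half of all pairs
    ([sieve_mass_lower]), and the sum of [1 / a] over the [a] free of primes up to
    [y] is at least logarithmic because it includes all [a] congruent to [1]
    modulo [y!] ([rough_harmonic_lower]). *)

(** * The prime-counting function: Chebyshev's lower bound and residues of indices *)

Lemma primepiE x : primepi x = \sum_(p < x.+1) prime p.
Proof. by rewrite /primepi -sum1_card big_mkcond; apply: eq_bigr => i _; rewrite !inE; case: prime. Qed.

Lemma primepiS x : primepi x.+1 = primepi x + prime x.+1.
Proof. by rewrite !primepiE big_ord_recr. Qed.

Lemma leq_expn2_central_bin N : 2 ^ N <= 'C(N.*2, N).
Proof.
elim: N => [//|N IH]; rewrite doubleS expnS mulSn mul1n binS leq_add //.
  by rewrite binS (leq_trans IH) // leq_addl.
by case: N IH => [//|N] IH; rewrite binS (leq_trans IH) // leq_addr.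
Qed.

(** By Legendre's formula the exponent is a sum over [k] of
    [2N %/ p^k - 2 (N %/ p^k)], whose terms are [0] or [1] and vanish once
    [p^k > 2N]. *)
Lemma pfactor_central_bin_leq p N : prime p -> 0 < N ->
  p ^ logn p 'C(N.*2, N) <= N.*2.
Proof.
move=> p_pr N0; have p1 := prime_gt1 p_pr.
have N20 : 0 < N.*2 by rewrite double_gt0.
have/andP[le_tr lt_tr] : p ^ trunc_log p N.*2 <= N.*2 < p ^ (trunc_log p N.*2).+1.
  exact: trunc_log_bounds.
apply: leq_trans le_tr; rewrite leq_pexp2l ?prime_gt0 //.
have leN : N <= N.*2 by rewrite -addnn leq_addr.
have := congr1 (logn p) (bin_fact leN).
rewrite -addnn addnK addnn lognM ?muln_gt0 ?fact_gt0 ?bin_gt0 //.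
rewrite lognM ?fact_gt0 // !logn_fact //.
set T := trunc_log p _ in lt_tr *.
(* All the sums in Legendre's formula can be cut at the same height [T]. *)
have TN : T < N.*2.+1 by rewrite ltnS ltnW // (leq_trans (ltn_expl _ p1)) // trunc_logP.
have cut n : n <= N.*2 -> \sum_(1 <= k < n.+1) n %/ p ^ k = \sum_(1 <= k < T.+1) n %/ p ^ k.
  move=> nN; have zero k : T < k -> n %/ p ^ k = 0.
    move=> Tk; rewrite divn_small // (leq_ltn_trans nN) // (leq_trans lt_tr) //.
    by rewrite leq_pexp2l ?prime_gt0.
  case: (leqP T n) => [Tn|nT].
    rewrite (big_cat_nat (n := T.+1)) //= [X in _ + X]big_nat [X in _ + X]big1 ?addn0 //.
    by move=> k /andP[Tk _]; exact: zero.
  rewrite [RHS](big_cat_nat (n := n.+1)) //=; last by rewrite ltnW.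
  rewrite [X in _ = _ + X]big_nat [X in _ = _ + X]big1 ?addn0 // => k /andP[nk _].
  rewrite divn_small //; exact: ltn_trans nk (ltn_expl _ p1).
rewrite (cut _ (leqnn _)) !(cut _ leN) => E.
rewrite -(leq_add2r (\sum_(1 <= k < T.+1) N %/ p ^ k + \sum_(1 <= k < T.+1) N %/ p ^ k)) E.
have TE : T = \sum_(1 <= k < T.+1) 1 by rewrite sum_nat_const_nat subn1 muln1.
rewrite [X in _ <= X + _]TE -!big_split /=.
apply: leq_sum => k _; rewrite -ltnS.
have pk0 : 0 < p ^ k by rewrite expn_gt0 prime_gt0.
rewrite ltn_divLR // {1}(divn_eq N (p ^ k)).
have := ltn_mod N (p ^ k); rewrite pk0 => H.
nia.
Qed.

(** Each of the at most [primepi (2N)] primes of ['C(2N, N)] contributes a factor at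
    most [2N]. *)
Lemma primepi_lower N : 0 < N -> 2 ^ N <= N.*2 ^ primepi N.*2.
Proof.
move=> N0; apply: leq_trans (leq_expn2_central_bin N) _.
have C0 : 0 < 'C(N.*2, N) by rewrite bin_gt0 -addnn leq_addr.
rewrite [X in X <= _](prod_prime_decomp C0) prime_decompE big_map /=.
have Ple p : p \in primes 'C(N.*2, N) -> p <= N.*2.
  move=> pP; have p_pr : prime p by move: pP; rewrite mem_primes => /andP[].
  apply: leq_trans (pfactor_central_bin_leq p_pr N0).
  by rewrite -[X in X <= _]expn1 leq_pexp2l ?(prime_gt0 p_pr) ?logn_gt0.
apply: (@leq_trans (\prod_(p <- primes 'C(N.*2, N)) N.*2)).
  rewrite big_seq [X in _ <= X]big_seq; apply: leq_prod => p pP.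
  by apply: pfactor_central_bin_leq => //; move: pP; rewrite mem_primes => /andP[].
rewrite big_const_seq count_predT iter_muln_1.
rewrite leq_pexp2l ?double_gt0 //.
rewrite primepiE -(big_mkord xpredT (fun p => prime p : nat)) -big_mkcond /= sum1_count.
rewrite -size_filter; apply: uniq_leq_size (primes_uniq _) _ => p pP.
rewrite mem_filter mem_index_iota /= ltnS Ple // andbT.
by move: pP; rewrite mem_primes => /andP[].
Qed.

(** Every block of [m] consecutive integers meets the class of [r]. *)
Lemma sum_residue_lower m r I : 0 < m ->
  I %/ m <= \sum_(i < I) (i.+1 == r %[mod m]).
Proof.
move=> m0; rewrite -(big_mkord xpredT (fun i => (i.+1 == r %[mod m]) : nat)).
rewrite [in X in _ <= X](divn_eq I m).
rewrite (big_cat_nat (n := I %/ m * m)) //= ?leq_addr //; apply: leq_trans (leq_addr _ _).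
elim: (I %/ m) => [//|q IH].
rewrite (big_cat_nat (n := q * m)) //= ?leq_mul // -[X in X <= _]addn1 leq_add //.
rewrite -{1}[q * m]add0n [q.+1 * m]mulSn big_addn addnK.
pose i := (r + m.-1) %% m.
have im : i < m by rewrite ltn_mod.
rewrite (big_rem i) /= ?mem_index_iota //.
suff -> : (i + q * m).+1 == r %[mod m] by [].
rewrite /i -addSn addnC modnMDl -addn1 modnDml -addnA addn1 prednK // modnDr //.
Qed.

(** The index [primepi p] of a prime [p] runs exactly once through
    [1, ..., primepi x] as [p] runs through the primes up to [x]. *)
Lemma sum_primepi (f : nat -> nat) x :
  \sum_(p < x.+1 | prime p) f (primepi p) = \sum_(i < primepi x) f i.+1.
Proof.
rewrite big_mkcond; elim: x => [|x IH]; first by rewrite primepiE !big_ord1 big_ord0.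
rewrite big_ord_recr /= primepiS IH.
case: (prime x.+1) => /=; last by rewrite !addn0.
by rewrite addn1 big_ord_recr.
Qed.

Lemma primepi_prime_free p j :
  (forall h, 0 < h <= j -> ~~ prime (p + h)) -> primepi (p + j) = primepi p.
Proof.
elim: j => [|j IH] np; first by rewrite addn0.
rewrite addnS primepiS IH => [|h hj]; last by apply: np; lia.
by rewrite -addnS (negbTE (np _ _)) ?addn0 //=.
Qed.

Section Sieve.
Local Open Scope ring_scope.

(** * Sums of products of periodic functions *)

Definition periodic (R : Type) (L : nat) (f : nat -> R) :=
  forall N, f (N %% L)%N = f N.

Lemma periodic_dvdn (R : Type) (f : nat -> R) (L K : nat) :
  (L %| K)%N -> periodic L f -> periodic K f.
Proof. by move=> LK pf N; rewrite -pf modn_dvdm // pf. Qed.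

(** The Chinese remainder theorem says that [N] modulo [a] and [N] modulo [b] vary
    independently over a period of length [a * b]. *)
Lemma sum_coprime_periods (R : comNzRingType) (a b : nat) (f g : nat -> R) :
  (0 < a)%N -> (0 < b)%N -> coprime a b -> periodic a f -> periodic b g ->
  \sum_(N < a * b) f N * g N = (\sum_(N < a) f N) * (\sum_(N < b) g N).
Proof.
move=> a0 b0 ab pf pg.
rewrite big_distrl /=.
under [RHS]eq_bigr => i _ do rewrite big_distrr.
rewrite pair_big /=.
(* Injectivity suffices for bijectivity, both sides having [a * b] elements. *)
pose c (N : 'I_(a * b)) : 'I_a * 'I_b :=
  (Ordinal (ltn_pmod N a0), Ordinal (ltn_pmod N b0)).
have c_inj : injective c.
  move=> N1 N2 [/eqP e1 /eqP e2]; apply/val_inj => /=.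
  have : (N1 == N2 %[mod a * b])%N by rewrite chinese_remainder // e1 e2.
  by rewrite !modn_small => // /eqP.
have c_bij : bijective c.
  by apply: inj_card_bij => //; rewrite card_prod !card_ord.
rewrite [RHS](reindex c) /=; last exact: onW_bij.
by apply: eq_bigr => N _; rewrite pf pg.
Qed.

Lemma sum_prod_periodic (R : comNzRingType) (s : seq nat) (f : nat -> nat -> R) :
  uniq s -> {in s, forall p, prime p} -> {in s, forall p, periodic p (f p)} ->
  \sum_(N < \prod_(p <- s) p) \prod_(p <- s) f p N =
  \prod_(p <- s) \sum_(N < p) f p N.
Proof.
elim: s => [|q s IH] /=; first by rewrite !big_nil big_ord1 big_nil.
case/andP=> qs us sP sf.
have sP' : {in s, forall p, prime p} by move=> p ps; apply: sP; rewrite inE ps orbT.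
have sf' : {in s, forall p, periodic p (f p)} by move=> p ps; apply: sf; rewrite inE ps orbT.
have qP : prime q by apply: sP; rewrite mem_head.
rewrite !big_cons -IH //.
under eq_bigr => N _ do rewrite big_cons.
rewrite (sum_coprime_periods (f := f q) (g := fun N => \prod_(p <- s) f p N)) //.
- exact: prime_gt0.
- by rewrite big_seq prodn_cond_gt0 // => p /sP' /prime_gt0.
- rewrite big_seq; elim/big_ind: _ => [|x y cx cy|p ps]; first exact: coprimen1.
    by rewrite coprimeMr cx.
  by rewrite prime_coprime // dvdn_prime2 ?(sP' p) //; apply: contraNneq qs => ->.
- by apply: sf; rewrite mem_head.
- move=> N; rewrite big_seq [RHS]big_seq; apply: eq_bigr => p ps.
  by apply: (periodic_dvdn _ (sf' _ ps)); rewrite (big_rem p ps) dvdn_mulr.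
Qed.

(** Full periods contribute exactly; the incomplete last one, at most its length. *)
Lemma sum_periodic_le (R : realFieldType) (L x : nat) (f : nat -> R) : (0 < L)%N ->
  periodic L f -> (forall N, f N <= 1) -> 0 <= \sum_(N < L) f N ->
  \sum_(N < x) f N <= x%:R / L%:R * (\sum_(N < L) f N) + L%:R.
Proof.
move=> L0 pf f1 S0; set S := \sum_(N < L) f N.
have Lr : (0 : R) < L%:R by rewrite ltr0n.
have block q r : \sum_(N < q * L + r) f N = q%:R * S + \sum_(N < r) f N.
  rewrite big_split_ord /=; congr (_ + _); last first.
    by apply: eq_bigr => i _ /=; rewrite -pf modnMDl pf.
  elim: q => [|q IH]; first by rewrite mul0n mul0r big_ord0.
  rewrite mulSnr big_split_ord /= IH -natr1 mulrDl mul1r; congr (_ + _).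
  by apply: eq_bigr => i _ /=; rewrite -pf modnMDl pf.
have -> : \sum_(N < x) f N = \sum_(N < x %/ L * L + x %% L) f N by rewrite -divn_eq.
rewrite block lerD //.
  rewrite ler_wpM2r // ler_pdivlMr // -natrM ler_nat leq_trunc_div //.
apply: le_trans (_ : \sum_(N < x %% L) 1 <= _); first exact: ler_sum.
by rewrite sumr_const card_ord ler_nat ltnW // ltn_mod.
Qed.

(** * An orthogonal system for the two residue classes of N(N + h) *)

Definition rough (y n : nat) := (0 < n)%N && all (fun p => y < p)%N (primes n).

Definition sqfree (n : nat) := (0 < n)%N && all (fun p => logn p n == 1%N) (primes n).

(** A squarefree number is determined by its set of prime factors, which is
    what separates distinct [d] in the orthogonality relation. *)
Lemma sqfree_prod n : sqfree n -> (\prod_(p <- primes n) p)%N = n.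
Proof.
case/andP=> n0 /allP sq; rewrite [RHS](prod_prime_decomp n0) prime_decompE big_map /=.
by rewrite big_seq [RHS]big_seq; apply: eq_bigr => p /sq /eqP ->.
Qed.

Lemma prod_primes_leq n : (0 < n)%N -> (\prod_(p <- primes n) p <= n)%N.
Proof.
move=> n0; rewrite [X in (_ <= X)%N](prod_prime_decomp n0) prime_decompE big_map /=.
rewrite big_seq [X in (_ <= X)%N]big_seq; apply: leq_prod => p pn.
rewrite -[X in (X <= _)%N]expn1 leq_pexp2l ?logn_gt0 //.
by move: pn; rewrite mem_primes => /andP[/prime_gt0].
Qed.

(** The value on the two classes [0] and [-h] is the one that makes the mean over a
    period zero. *)
Definition psi (h p N : nat) : rat :=
  if (p %| N * (N + h))%N then - ((p%:R - 2) / 2) else 1.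

(** The inverse of the mean square of [psi h p], for [p] a prime not dividing [2h].
    It is also minus the inverse of the value of [psi h p] on the two classes, so
    that [wt p * psi h p] stays bounded by [1]. *)
Definition wt (p : nat) : rat := 2 / (p%:R - 2).

Lemma psi_periodic h p : periodic p (psi h p).
Proof. by move=> N; rewrite /psi /dvdn -modnMm modnDml modn_mod modnMm. Qed.

Lemma card_hits h p : prime p -> (0 < h < p)%N ->
  #|[pred N : 'I_p | p %| N * (N + h)]%N| = 2.
Proof.
move=> pP /andP[h0 hp]; have p0 := prime_gt0 pP.
have lt1 : (p - h < p)%N by lia.
pose i0 := Ordinal p0; pose i1 := Ordinal lt1.
rewrite (eq_card (B := pred2 i0 i1)); last first.
  move=> N; rewrite !inE -!val_eqE /= Euclid_dvdM //.
  have Np := ltn_ord N.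
  case: (posnP N) => [->|N0]; first by rewrite dvdn0.
  rewrite [(p %| N)%N]gtnNdvd //=.
  apply/idP/eqP => [/dvdnP[k]|->]; last by rewrite subnK // ltnW.
  by case: k => [|[|k]]; nia.
by rewrite card2 -val_eqE /=; case: eqP => //; lia.
Qed.

Lemma sum_if_hits (h p : nat) (a b : rat) : prime p -> (0 < h < p)%N ->
  \sum_(N < p) (if (p %| N * (N + h))%N then a else b) = 2 * a + (p%:R - 2) * b.
Proof.
move=> pP hp; rewrite (eq_bigr (fun N : 'I_p => b + (if (p %| N * (N + h))%N then a - b else 0))).
  rewrite big_split /= sumr_const card_ord -big_mkcond /= sumr_const card_hits //.
  by rewrite -mulr_natl -[_ *+ 2]mulr_natl; ring.
by move=> N _; case: ifP => _; ring.
Qed.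

Lemma natr_prime_gt2 p : (2 < p)%N -> (0 : rat) < p%:R - 2.
Proof. by move=> p2; rewrite subr_gt0 ltr_nat. Qed.

Lemma sum_wt_psi h p : prime p -> (0 < h < p)%N -> (2 < p)%N ->
  \sum_(N < p) (wt p * psi h p N) = 0.
Proof.
move=> pP hp p2; rewrite -big_distrr /= sum_if_hits //.
by have := natr_prime_gt2 p2; set q := p%:R => q2; rewrite /wt; field; lra.
Qed.

Lemma sum_wt_psi_sqr h p : prime p -> (0 < h < p)%N -> (2 < p)%N ->
  \sum_(N < p) (wt p * psi h p N) ^+ 2 = p%:R * wt p.
Proof.
move=> pP hp p2; have := natr_prime_gt2 p2 => q2.
under eq_bigr => N _ do rewrite /psi fun_if (fun_if (fun z => z ^+ 2)).
by rewrite sum_if_hits // /wt -/(p%:R); field; lra.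
Qed.

Lemma wt_psi_norm_le1 h p N : (3 < p)%N -> `|wt p * psi h p N| <= 1.
Proof.
move=> p3; have q4 : (4 : rat) <= p%:R by rewrite ler_nat.
have w0 : 0 < wt p by rewrite divr_gt0 //; lra.
rewrite normrM gtr0_norm // /psi; case: ifP => _.
  rewrite normrN ger0_norm; last by rewrite divr_ge0 //; lra.
  by rewrite /wt le_eqVlt; apply/orP; left; apply/eqP; field; lra.
by rewrite normr1 mulr1 /wt ler_pdivrMr; lra.
Qed.

Definition wpsi (h d N : nat) : rat := \prod_(p <- primes d) (wt p * psi h p N).

Definition wtn (d : nat) : rat := \prod_(p <- primes d) wt p.

Lemma rough_prime y d p : rough y d -> p \in primes d -> prime p /\ (y < p)%N.
Proof.
case/andP=> _ /allP r pd; split; last exact: r.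
by move: pd; rewrite mem_primes => /andP[].
Qed.

Lemma wpsi_norm_le1 y h d N : (3 <= y)%N -> rough y d -> `|wpsi h d N| <= 1.
Proof.
move=> y3 rd; rewrite /wpsi big_seq normr_prod.
apply: prodr_ile1 => p pd; rewrite normr_ge0 wt_psi_norm_le1 //.
by have [_ yp] := rough_prime rd pd; apply: leq_ltn_trans yp.
Qed.

Lemma prod_primes_subset (R : comNzRingType) (d e : nat) (F : nat -> R) :
  {subset primes d <= primes e} ->
  \prod_(p <- primes e) (if p \in primes d then F p else 1) = \prod_(p <- primes d) F p.
Proof.
move=> de; rewrite -big_mkcond /= -big_filter; apply: perm_big.
apply: uniq_perm; rewrite ?filter_uniq ?primes_uniq // => p.
by rewrite mem_filter; case: (boolP (p \in primes d)) => // /de.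
Qed.

(** The sum over a period factors over the primes of [d * e]. A prime dividing
    only one of [d] and [e] contributes the factor [0], and a prime dividing both
    contributes [p * wt p]. *)
Lemma wpsi_orthogonal y h d e (L := (\prod_(p <- primes (d * e)) p)%N) :
  (0 < h <= y)%N -> (2 <= y)%N -> rough y d -> rough y e -> sqfree d -> sqfree e ->
  \sum_(N < L) (wpsi h d N * wpsi h e N) = (if d == e then L%:R * wtn d else 0).
Proof.
rewrite {}/L => /andP[h0 hy] y2 rd re sd se.
have d0 : (0 < d)%N by case/andP: rd.
have e0 : (0 < e)%N by case/andP: re.
pose f c p N : rat := if p \in primes c then wt p * psi h p N else 1.
have inM p : (p \in primes (d * e)) = (p \in primes d) || (p \in primes e).
  by rewrite primesM.
have pde p : p \in primes (d * e) -> [/\ prime p, (0 < h < p)%N & (2 < p)%N].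
  rewrite inM => pp; have [pP yp] : prime p /\ (y < p)%N.
    by case/orP: pp; apply: rough_prime.
  by split => //; lia.
have prodE N : \prod_(p <- primes (d * e)) (f d p N * f e p N) = wpsi h d N * wpsi h e N.
  by rewrite big_split /= !prod_primes_subset // => p pp; rewrite inM pp ?orbT.
rewrite -(eq_bigr _ (fun N _ => prodE (nat_of_ord N))).
rewrite (sum_prod_periodic (f := fun p N => f d p N * f e p N)); first last.
- by move=> p _ N; rewrite /f psi_periodic.
- by move=> p /pde[].
- exact: primes_uniq.
have [<-|ned] := eqVneq d e.
  have -> : primes (d * d) = primes d.
    by apply/eq_primes => p; rewrite primesM // orbb.
  rewrite /wtn natr_prod -big_split big_seq [RHS]big_seq; apply: eq_bigr => p pd /=.
  have [|pP hp p2] := pde p; first by rewrite inM pd.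
  by rewrite /f pd; under eq_bigr => N _ do rewrite -expr2; rewrite sum_wt_psi_sqr.
have [p pp ndp] : exists2 p, p \in primes (d * e) & (p \in primes d) != (p \in primes e).
  apply/allPn; apply: contraNN ned => /allP eq_de.
  rewrite -(sqfree_prod sd) -(sqfree_prod se); apply/eqP; congr (bigop _ _ _).
  apply/eq_primes => p; have := eq_de p; rewrite inM.
  by case: (p \in primes d) (p \in primes e) => [] [] // /(_ isT).
have [pP hp p2] := pde p pp.
rewrite (big_rem p pp) /=.
rewrite [X in X * _](_ : _ = 0) ?mul0r // -[RHS](sum_wt_psi pP hp p2).
by apply: eq_bigr => N _; rewrite /f; case: (p \in primes d) (p \in primes e) ndp => [] []; rewrite ?mulr1 ?mul1r.
Qed.

(** * The upper-bound sieve *)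

Definition admissible y d := rough y d && sqfree d.

Definition sieve_mass (y D : nat) : rat := \sum_(d < D | admissible y d) wtn d.

Definition sifted (y D h N : nat) : bool :=
  [forall p : 'I_D, prime p && (y < p)%N ==> ~~ (p %| N * (N + h))%N].

Lemma wpsi_sifted y D h N d : (d < D)%N -> admissible y d -> sifted y D h N ->
  wpsi h d N = wtn d.
Proof.
move=> dD /andP[rd _] /forallP sN; rewrite /wpsi /wtn big_seq [RHS]big_seq.
apply: eq_bigr => p pd; have [pP yp] := rough_prime rd pd.
have pD : (p < D)%N.
  by apply: leq_ltn_trans dD; move: pd; rewrite mem_primes => /and3P[_ d0 /dvdn_leq ->].
by have /implyP := sN (Ordinal pD); rewrite /= pP yp /psi => /(_ isT)/negbTE ->; rewrite mulr1.
Qed.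

Lemma wtn_ge0 y d : (2 <= y)%N -> rough y d -> 0 <= wtn d.
Proof.
move=> y2 rd; rewrite /wtn big_seq; apply: prodr_ge0 => p pd.
have [_ yp] := rough_prime rd pd.
by rewrite divr_ge0 // ltW // natr_prime_gt2 // (leq_ltn_trans y2).
Qed.

Lemma sum_wpsi_le y h D x d e : (0 < h <= y)%N -> (3 <= y)%N ->
  (d < D)%N -> (e < D)%N -> admissible y d -> admissible y e ->
  \sum_(N < x) wpsi h d N * wpsi h e N <= x%:R * (if d == e then wtn d else 0) + (D ^ 2)%:R.
Proof.
move=> hy y3 dD eD /andP[rd sd] /andP[re se].
set L := (\prod_(p <- primes (d * e)) p)%N.
have de0 : (0 < d * e)%N by rewrite muln_gt0; case/andP: rd => ->; case/andP: re.
have L0 : (0 < L)%N.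
  by rewrite /L big_seq prodn_cond_gt0 // => p; rewrite mem_primes => /andP[/prime_gt0].
have orth := wpsi_orthogonal hy (ltnW y3) rd re sd se.
have sub c : (0 < c)%N -> {subset primes c <= primes (d * e)} -> periodic L (wpsi h c).
  move=> c0 cde N; rewrite /wpsi big_seq [RHS]big_seq; apply: eq_bigr => p pc.
  congr (_ * _); apply: (periodic_dvdn _ (@psi_periodic h p)).
  by rewrite /L (big_rem p (cde p pc)) dvdn_mulr.
have [d0 e0] : (0 < d)%N /\ (0 < e)%N by apply/andP; rewrite -muln_gt0.
have perL : periodic L (fun N => wpsi h d N * wpsi h e N).
  by move=> N; rewrite !sub // => p pp; rewrite primesM // pp ?orbT.
have le1 N : wpsi h d N * wpsi h e N <= 1.
  apply: le_trans (ler_norm _) _; rewrite normrM.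
  by apply: mulr_ile1 => //; apply: wpsi_norm_le1 y3 _.
have S0 : 0 <= \sum_(N < L) wpsi h d N * wpsi h e N.
  by rewrite orth; case: ifP => // _; rewrite mulr_ge0 // (wtn_ge0 (ltnW y3)).
apply: le_trans (sum_periodic_le x L0 perL le1 S0) _; rewrite orth.
have Lr : (L%:R : rat) != 0 by rewrite pnatr_eq0 -lt0n.
rewrite lerD //.
  by case: ifP => _; rewrite ?mulr0 // mulrA divfK.
rewrite ler_nat (leq_trans (prod_primes_leq de0)) //.
by rewrite -mulnn leq_mul // ltnW.
Qed.

(** The sum of [F N ^+ 2] over [N < x], where [F N] is the sum of the [wpsi h d N],
    is bounded below by its terms at sifted [N], where [F N] is the whole mass,
    and bounded above by orthogonality. Each of the at most [D ^ 2] pairs [(d, e)]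
    has a period at most [D ^ 2], whence the error term. *)
Lemma sieve_bound y h D x : (0 < h <= y)%N -> (3 <= y)%N ->
  (\sum_(N < x | sifted y D h N) 1) * sieve_mass y D ^+ 2 <=
  x%:R * sieve_mass y D + (D ^ 4)%:R.
Proof.
move=> hy y3; set G := sieve_mass y D.
pose F N := \sum_(d < D | admissible y d) wpsi h d N.
apply: (@le_trans _ _ (\sum_(N < x) F N ^+ 2)).
  rewrite mulr_suml [X in X <= _]big_mkcond; apply: ler_sum => N _.
  case: ifP => [sN|_]; last exact: sqr_ge0.
  rewrite mul1r; have -> // : F N = G.
  by apply: eq_bigr => d ad; rewrite (wpsi_sifted _ ad sN).
have -> : \sum_(N < x) F N ^+ 2 = \sum_(d < D | admissible y d) \sum_(e < D | admissible y e)
    \sum_(N < x) wpsi h d N * wpsi h e N.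
  rewrite (eq_bigr (fun N : 'I_x => \sum_(d < D | admissible y d) \sum_(e < D | admissible y e)
      wpsi h d N * wpsi h e N)).
    by rewrite exchange_big; apply: eq_bigr => d _; rewrite exchange_big.
  by move=> N _; rewrite expr2 /F big_distrl; apply: eq_bigr => d _; rewrite big_distrr.
apply: (@le_trans _ _ (\sum_(d < D | admissible y d) (x%:R * wtn d + (D ^ 3)%:R))).
  apply: ler_sum => d ad.
  apply: (@le_trans _ _ (\sum_(e < D | admissible y e)
    (x%:R * (if d == e :> nat then wtn d else 0) + (D ^ 2)%:R))).
    by apply: ler_sum => e ae; apply: (sum_wpsi_le x hy y3).
  rewrite big_split /= lerD //.
    rewrite -mulr_sumr ler_wpM2l // -big_mkcondr (big_pred1 d) // => e.
    rewrite /= -[RHS]val_eqE /= eq_sym; case: eqP => [/val_inj ->|_]; last by rewrite andbF.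
    by rewrite andbT.
  rewrite sumr_const -mulrnA ler_nat [X in (_ <= X)%N]expnSr leq_mul //.
  by rewrite (leq_trans (max_card _)) // card_ord.
rewrite big_split /= -mulr_sumr lerD // sumr_const -mulrnA ler_nat.
by rewrite [X in (_ <= X)%N]expnSr leq_mul // (leq_trans (max_card _)) // card_ord.
Qed.

Lemma sum_inj_le (I J : finType) (P : pred I) (Q : pred J) (f : I -> J) (F : J -> rat) :
  {in P &, injective f} -> (forall i, P i -> Q (f i)) -> (forall j, Q j -> 0 <= F j) ->
  \sum_(i | P i) F (f i) <= \sum_(j | Q j) F j.
Proof.
move=> f_inj PQ F0.
have -> : \sum_(i | P i) F (f i) = \sum_(j in [set f i | i in P]%SET) F j.
  by rewrite big_imset.
rewrite [leRHS](bigID (mem [set f i | i in P]%SET)) /=.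
rewrite [X in _ <= X + _](eq_bigl (mem [set f i | i in P]%SET)).
  by rewrite lerDl sumr_ge0 // => j /andP[/F0].
move=> j /=; case: (boolP (j \in _)) => [/imsetP[i iP ->]|_]; last by rewrite andbF.
by rewrite PQ.
Qed.

Lemma sqfree_dvd a d : (a %| d)%N -> sqfree d -> sqfree a.
Proof.
move=> ad /andP[d0 /allP sd]; have a0 := dvdn_gt0 d0 ad.
rewrite /sqfree a0; apply/allP => p pa /=.
have pd : p \in primes d.
  by move: pa; rewrite !mem_primes d0 => /and3P[-> _ /dvdn_trans ->].
rewrite eqn_leq logn_gt0 pa andbT.
by rewrite -(eqP (sd p pd)) dvdn_leq_log.
Qed.

(** A divisor of a squarefree [d] is the product of a subset of the primes of [d],
    so a factorization is determined by that subset. *)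
Lemma card_factorizations E d : sqfree d ->
  (#|[pred ab : 'I_E * 'I_E | ab.1 * ab.2 == d]%N| <= 2 ^ size (primes d))%N.
Proof.
move=> sd; have d0 : (0 < d)%N by case/andP: sd.
pose T := (size (primes d)).-tuple bool.
pose f (ab : 'I_E * 'I_E) : T := [tuple of map (fun p => p %| ab.1)%N (in_tuple (primes d))].
rewrite -card_bool -card_tuple; apply: (@leq_card_in _ _ f).
have key (a b : 'I_E) : (a * b)%N = d -> (a : nat) = (\prod_(p <- primes d | p %| a) p)%N.
  move=> abd; have ad : (a %| d)%N by rewrite -abd dvdn_mulr.
  rewrite -{1}(sqfree_prod (sqfree_dvd ad sd)) -[RHS]big_filter; apply: perm_big.
  apply: uniq_perm; rewrite ?filter_uniq ?primes_uniq // => p.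
  rewrite mem_filter !mem_primes d0 (dvdn_gt0 d0 ad) /=.
  case: (prime p) => //=; last by rewrite andbF.
  by case pa : (p %| a)%N => //=; rewrite (dvdn_trans pa ad).
move=> [a b] [a' b']; rewrite !inE /= => /eqP ab /eqP ab' /(congr1 val) /= /eq_in_map eqf.
have aa' : a = a'.
  apply: val_inj; rewrite /= (key _ _ ab) (key _ _ ab') big_seq_cond [RHS]big_seq_cond.
  by apply: eq_bigl => p; case: (boolP (p \in primes d)) => //= /eqf ->.
rewrite -aa' in ab' *; congr (_, _); apply: val_inj.
have a0 : (0 < a)%N by rewrite lt0n; apply: contraTneq d0 => a0; rewrite -ab a0.
by apply/eqP; rewrite -(eqn_pmul2l a0) ab ab'.
Qed.

Lemma wtn_lower y d : (2 <= y)%N -> admissible y d ->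
  (2 ^ size (primes d))%:R / d%:R <= wtn d.
Proof.
move=> y2 /andP[rd sd]; rewrite -{2}(sqfree_prod sd) /wtn natr_prod -prodfV.
have -> : (2 ^ size (primes d))%:R = \prod_(p <- primes d) (2 : rat).
  by rewrite big_const_seq count_predT iter_mulr_1 natrX.
rewrite -big_split big_seq [leRHS]big_seq; apply: ler_prod => p pd /=.
have [_ yp] := rough_prime rd pd; have := natr_prime_gt2 (leq_ltn_trans y2 yp).
set q : rat := p%:R => q2; have q0 : 0 < q by lra.
rewrite mulr_ge0 ?invr_ge0 ?(ltW q0) //= /wt -/q ler_pM2l // lef_pV2 ?posrE //; lra.
Qed.

Lemma rough_dvd y a d : (a %| d)%N -> rough y d -> rough y a.
Proof.
move=> ad /andP[d0 /allP rd]; have a0 := dvdn_gt0 d0 ad.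
rewrite /rough a0; apply/allP => p pa; apply: rd.
by move: pa; rewrite !mem_primes d0 => /and3P[-> _ /dvdn_trans ->].
Qed.

Lemma rough_mul y a b : rough y a -> rough y b -> rough y (a * b).
Proof.
move=> /andP[a0 /allP ra] /andP[b0 /allP rb]; rewrite /rough muln_gt0 a0 b0.
by apply/allP => p; rewrite primesM // => /orP[/ra|/rb].
Qed.

(** Grouping the pairs by their product [d], there are at most [2^omega(d)] in each
    group, and [2^omega(d) / d <= wtn d]. *)
Lemma sieve_mass_ge_pairs y E : (2 <= y)%N ->
  \sum_(ab : 'I_E * 'I_E | [&& rough y ab.1, rough y ab.2 & sqfree (ab.1 * ab.2)])
     (ab.1%:R^-1 * ab.2%:R^-1) <= sieve_mass y (E * E).
Proof.
move=> y2.
pose f (ab : 'I_E * 'I_E) : 'I_(E * E) := Ordinal (ltn_mul (ltn_ord ab.1) (ltn_ord ab.2)).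
rewrite (partition_big f (fun d => admissible y d)) /=; last first.
  by move=> ab /and3P[ra rb sab]; rewrite /admissible rough_mul.
apply: ler_sum => d ad; apply: le_trans (wtn_lower y2 ad).
rewrite (eq_bigr (fun=> d%:R^-1)); last first.
  by move=> ab /andP[_ /eqP <-] /=; rewrite natrM invfM.
rewrite sumr_const -[_ *+ #|_|]mulr_natl ler_wpM2r ?invr_ge0 // ler_nat.
have sd : sqfree d by case/andP: ad.
apply: leq_trans (card_factorizations E sd); apply: subset_leq_card.
by apply/fintype.subsetP => ab; rewrite !inE => /andP[_ /eqP <-] /=.
Qed.

Definition rough_harmonic (y E : nat) : rat := \sum_(n < E | rough y n) n%:R^-1.

(** Rough numbers are closed under divisors, so division by [q] maps the rough
    multiples of [q] injectively into the rough numbers. *)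
Lemma rough_harmonic_dvd y E q : (0 < q)%N ->
  \sum_(n < E | rough y n && (q %| n)%N) n%:R^-1 <= q%:R^-1 * rough_harmonic y E.
Proof.
move=> q0.
have lt (n : 'I_E) : (n %/ q < E)%N by rewrite (leq_ltn_trans (leq_div _ _)).
pose f (n : 'I_E) : 'I_E := Ordinal (lt n).
rewrite (eq_bigr (fun n : 'I_E => q%:R^-1 * (f n)%:R^-1)); last first.
  by move=> n /andP[_ qn] /=; rewrite -invfM -natrM mulnC divnK.
rewrite -mulr_sumr ler_wpM2l ?invr_ge0 //.
apply: (sum_inj_le (F := fun n : 'I_E => (n%:R^-1 : rat))) => //.
  move=> n m /andP[_ qn] /andP[_ qm] /(congr1 val) /= e; apply: val_inj => /=.
  by rewrite -(divnK qn) -(divnK qm) e.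
by move=> n /andP[rn qn]; apply: rough_dvd rn => /=; apply/dvdnP; exists q; rewrite mulnC divnK.
by move=> j _; rewrite invr_ge0.
Qed.

Lemma sum_inv_squares y E : (0 < y)%N ->
  \sum_(p < E | (y < p)%N) (p%:R^-1 ^+ 2) <= (y%:R^-1 : rat).
Proof.
move=> y0.
suff H m : \sum_(y.+1 <= p < y.+1 + m) (p%:R^-1 ^+ 2) <= (y%:R^-1 - (y + m)%:R^-1 : rat).
  rewrite -(big_mkord (fun p => y < p)%N (fun p => p%:R^-1 ^+ 2)).
  have [Ey|yE] := leqP E y.+1.
    rewrite big_nat_cond big1 ?invr_ge0 // => p; lia.
  rewrite (big_cat_nat (n := y.+1)) ?(ltnW yE) //= [X in X + _]big_nat_cond [X in X + _]big1; last first.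
    by move=> p; lia.
  rewrite add0r -big_filter; have -> : [seq p <- index_iota y.+1 E | (y < p)%N] = index_iota y.+1 E.
    by apply/all_filterP/allP => p; rewrite mem_index_iota => /andP[].
  have := H (E - y.+1)%N; rewrite subnKC ?(ltnW yE) // => /le_trans; apply.
  by rewrite gerBl invr_ge0.
elim: m => [|m IH]; first by rewrite !addn0 big_geq // subrr.
rewrite addnS big_nat_recr ?leq_addr //= addSn.
have z0 : (0 : rat) < (y + m)%:R by rewrite ltr0n addn_gt0 y0.
rewrite -addnS addnS -[(y + m).+1%:R]natr1.
set z := (y + m)%:R in IH z0 *.
suff : ((z + 1)^-1 ^+ 2 : rat) <= z^-1 - (z + 1)^-1 by lra.
have -> : z^-1 - (z + 1)^-1 = (z * (z + 1))^-1 by field; lra.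
rewrite exprVn lef_pV2 ?posrE; nra.
Qed.

Lemma repeated_prime y E a b : (a < E)%N -> (b < E)%N -> rough y a -> rough y b ->
  ~~ sqfree (a * b) -> exists p : 'I_E, (y < p)%N /\
    [|| p ^ 2 %| a, p ^ 2 %| b | (p %| a) && (p %| b)]%N.
Proof.
move=> aE bE ra rb; have [a0 b0] : (0 < a)%N /\ (0 < b)%N by case/andP: ra; case/andP: rb.
rewrite /sqfree muln_gt0 a0 b0 /= => /allPn[p pab lp].
have [pP yp] := rough_prime (rough_mul ra rb) pab.
have l2 : (2 <= logn p a + logn p b)%N.
  by rewrite -lognM // ltn_neqAle eq_sym lp logn_gt0.
have pE : (p < E)%N.
  by move: pab; rewrite primesM // !mem_primes a0 b0 => /orP[] /andP[_] /dvdn_leq le;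
    [apply: leq_ltn_trans (le a0) aE | apply: leq_ltn_trans (le b0) bE].
exists (Ordinal pE); split=> //=.
rewrite !pfactor_dvdn // -[X in (X %| a)%N]expn1 -[X in (X %| b)%N]expn1 !pfactor_dvdn //.
lia.
Qed.

(** The square of the rough harmonic sum runs over all pairs [(a, b)]. If [a * b]
    is not squarefree, some prime [p > y] has [p^2] dividing [a], or [p^2] dividing
    [b], or [p] dividing both; each of the three cases has weight at most [p^-2]
    of the total. As the sum of [p^-2] over [p > y] is at most [1 / y <= 1 / 6], these pairs
    carry at most half of the total. *)
Lemma sieve_mass_lower y E : (6 <= y)%N ->
  rough_harmonic y E ^+ 2 / 2 <= sieve_mass y (E * E).
Proof.
move=> y6; set T := rough_harmonic y E.
apply: le_trans (sieve_mass_ge_pairs E (leq_trans _ y6)) => //.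
pose sq := \sum_(a < E | rough y a) \sum_(b < E | rough y b && sqfree (a * b))
  (a%:R^-1 * b%:R^-1 : rat).
pose nsq := \sum_(a < E | rough y a) \sum_(b < E | rough y b && ~~ sqfree (a * b))
  (a%:R^-1 * b%:R^-1 : rat).
rewrite [leRHS](_ : _ = sq); last by rewrite /sq pair_big_dep.
have split_T : T ^+ 2 = sq + nsq.
  rewrite expr2 /T /rough_harmonic big_distrlr -big_split; apply: eq_bigr => a _ /=.
  by rewrite [LHS](bigID (fun b : 'I_E => sqfree (a * b))).
pose u q (a : nat) : rat := if (q %| a)%N then a%:R^-1 else 0.
have u0 q a : 0 <= u q a by rewrite /u; case: ifP => // _; rewrite invr_ge0.
have uT q : (0 < q)%N -> \sum_(a < E | rough y a) u q a <= q%:R^-1 * T.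
  by move=> q0; rewrite -big_mkcondr; apply: rough_harmonic_dvd.
have u1 a : u 1%N a = a%:R^-1 by rewrite /u dvd1n.
pose v p (a b : nat) := u (p ^ 2)%N a * u 1%N b + u 1%N a * u (p ^ 2)%N b + u p a * u p b.
have v0 p a b : 0 <= v p a b by rewrite /v !addr_ge0 ?mulr_ge0.
have nsq_le : nsq <= \sum_(a < E | rough y a) \sum_(b < E | rough y b)
    \sum_(p < E | (y < p)%N) v p a b.
  apply: ler_sum => a ra; rewrite big_mkcondr; apply: ler_sum => b rb.
  case: ifP => [nsq_ab|_]; last exact: sumr_ge0.
  have [p [yp div]] := repeated_prime (ltn_ord a) (ltn_ord b) ra rb nsq_ab.
  rewrite (bigD1 p) //=; apply: (@le_trans _ _ (v p a b)); last first.
    by rewrite lerDl sumr_ge0.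
  rewrite /v !u1.
  have a0 : (0 : rat) <= a%:R^-1 by rewrite invr_ge0.
  have b0 : (0 : rat) <= b%:R^-1 by rewrite invr_ge0.
  have := mulr_ge0 (u0 (p ^ 2)%N a) b0; have := mulr_ge0 a0 (u0 (p ^ 2)%N b).
  have := mulr_ge0 (u0 p a) (u0 p b); have := mulr_ge0 a0 b0.
  rewrite /u; case/or3P: div => [->|->|/andP[-> ->]]; lra.
have bound : nsq <= \sum_(p < E | (y < p)%N) (3 * T ^+ 2 * (p%:R^-1 ^+ 2)).
  apply: le_trans nsq_le _.
  under eq_bigr => a _ do rewrite exchange_big.
  rewrite exchange_big; apply: ler_sum => p yp /=.
  have p0 : (0 < p)%N by apply: leq_ltn_trans yp.
  have p20 : (0 < p ^ 2)%N by rewrite expn_gt0 p0.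
  have S0 q : 0 <= \sum_(a < E | rough y a) u q a by apply: sumr_ge0.
  under eq_bigr => a _ do rewrite !big_split.
  rewrite !big_split /= -!big_distrlr /=.
  have := ler_pM (S0 _) (S0 _) (uT _ p20) (uT _ (ltn0Sn 0)).
  have := ler_pM (S0 _) (S0 _) (uT _ (ltn0Sn 0)) (uT _ p20).
  have := ler_pM (S0 _) (S0 _) (uT _ p0) (uT _ p0).
  rewrite natrX invr1 -exprVn.
  by set A := \sum_(i < E | _) _; lra.
have sq_le : \sum_(p < E | (y < p)%N) (3 * T ^+ 2 * (p%:R^-1 ^+ 2)) <= T ^+ 2 / 2.
  rewrite -mulr_sumr.
  have := @sum_inv_squares y E (leq_trans _ y6) => /(_ isT) le_y.
  have y6' : (y%:R^-1 : rat) <= 6^-1.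
    by rewrite lef_pV2 ?posrE ?ltr0n ?ler_nat // (leq_trans _ y6).
  have T20 : 0 <= 3 * T ^+ 2 by rewrite mulr_ge0 ?sqr_ge0.
  have := ler_wpM2l T20 (le_trans le_y y6'); lra.
rewrite split_T in bound sq_le *; lra.
Qed.

(** Each dyadic block contributes at least [1 / 2]. *)
Lemma harmonic_lower s : s%:R / 2 <= \sum_(k < 2 ^ s) (k.+1%:R^-1 : rat).
Proof.
elim: s => [|s IH]; first by rewrite mul0r sumr_ge0 // => k _; rewrite invr_ge0.
rewrite expnS mul2n -addnn big_split_ord /= -natr1 mulrDl lerD //.
apply: (@le_trans _ _ (\sum_(k < 2 ^ s) (2 ^ s.+1)%:R^-1)).
  rewrite sumr_const card_ord -[_ *+ (2 ^ s)]mulr_natl expnS natrM invfM.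
  by rewrite mulrCA mulfV ?mulr1 ?mul1r // pnatr_eq0 expn_eq0.
apply: ler_sum => k _; rewrite lef_pV2 ?posrE ?ltr0n ?expn_gt0 // ler_nat.
by rewrite expnS mul2n -addnn -addnS leq_add2l.
Qed.

(** The numbers [1 + y! k] are coprime to [y!], hence free of primes up to [y]. *)
Lemma rough_harmonic_lower y s : (2 <= y)%N ->
  s%:R / (2 * (y`!)%:R) <= rough_harmonic y (y`! * 2 ^ s).
Proof.
move=> y2; set M := y`!; have M0 : (0 < M)%N := fact_gt0 y.
have M2 : (2 <= M)%N by rewrite (leq_trans y2) // /M; case: (y) y2 => // z _; rewrite factS leq_pmulr ?fact_gt0.
have lt (k : 'I_(2 ^ s)) : (1 + M * k < M * 2 ^ s)%N.
  have := ltn_ord k; set K := (2 ^ s)%N => kK; nia.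
apply: (@le_trans _ _ (\sum_(k < 2 ^ s) (1 + M * k)%:R^-1)); last first.
  apply: (sum_inj_le (P := xpredT) (f := fun k => Ordinal (lt k))
    (F := fun n : 'I_(M * 2 ^ s) => (n%:R^-1 : rat))).
  - move=> k l _ _ /(congr1 val) /= /addnI /eqP.
    by rewrite eqn_pmul2l // => /eqP e; apply: val_inj.
  - move=> k _; rewrite /rough /=; apply/allP => p.
    rewrite mem_primes => /and3P[pP _ pd]; rewrite ltnNge; apply/negP => py.
    have pM : (p %| M * k)%N by rewrite dvdn_mulr // dvdn_fact // prime_gt0.
    by move: pd; rewrite dvdn_addl // dvdn1 => /eqP p1; rewrite p1 in pP.
  - by move=> j _; rewrite invr_ge0.
apply: (@le_trans _ _ (\sum_(k < 2 ^ s) (M%:R^-1 * k.+1%:R^-1))).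
  have -> : s%:R / (2 * M%:R) = M%:R^-1 * (s%:R / 2) :> rat by rewrite invfM; ring.
  by rewrite -mulr_sumr ler_wpM2l ?invr_ge0 // harmonic_lower.
apply: ler_sum => k _; rewrite -invfM -natrM lef_pV2 ?posrE ?ltr0n ?muln_gt0 ?M0 //.
by rewrite ler_nat mulnS leq_add2r.
Qed.

(** The sieving level is the square of [y! 2^s], so the mass [G] is at least
    [s^2 / (8 y!^2)], which is inserted into [x / G + D^4 / G^2]. *)
Lemma sifted_count_le y h s x : (0 < h <= y)%N -> (6 <= y)%N -> (0 < s)%N ->
  \sum_(N < x | sifted y ((y`! * 2 ^ s) * (y`! * 2 ^ s)) h N) (1 : rat) <=
  x%:R * (8 * (y`!)%:R ^+ 2) / s%:R ^+ 2 + 64 * (y`!)%:R ^+ 12 * 2 ^+ (8 * s).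
Proof.
move=> hy y6 s0; set M := y`!; set E := (M * 2 ^ s)%N.
have y3 : (3 <= y)%N by apply: leq_trans y6.
have := sieve_bound (E * E) x hy y3.
set cnt := \sum_(N < x | _) _; set G := sieve_mass _ _.
have M1 : (1 : rat) <= M%:R by rewrite ler1n fact_gt0.
have s1 : (1 : rat) <= s%:R by rewrite ler1n.
have T_ge : s%:R / (2 * M%:R) <= rough_harmonic y E.
  by apply: rough_harmonic_lower; apply: leq_trans y6.
have g0 : 0 < s%:R ^+ 2 / (8 * M%:R ^+ 2) :> rat.
  by rewrite divr_gt0 ?mulr_gt0 ?exprn_gt0 //; lra.
have G_ge : s%:R ^+ 2 / (8 * M%:R ^+ 2) <= G.
  apply: le_trans (sieve_mass_lower E y6).
  have t0 : (0 : rat) <= s%:R / (2 * M%:R) by rewrite divr_ge0 //; lra.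
  have := ler_pM t0 t0 T_ge T_ge; rewrite -!expr2 => le2.
  apply: (@le_trans _ _ ((s%:R / (2 * M%:R)) ^+ 2 / 2)); last by lra.
  by rewrite le_eqVlt; apply/orP; left; apply/eqP; field; lra.
have -> : ((E * E) ^ 4)%:R = M%:R ^+ 8 * 2 ^+ (8 * s) :> rat.
  rewrite mulnn -expnM /E expnMn -expnM natrM !natrX; congr (_ * _ ^+ _); lia.
set g := _ / _ in g0 G_ge.
have -> : x%:R * (8 * M%:R ^+ 2) / s%:R ^+ 2 = x%:R * g^-1 :> rat.
  by rewrite /g; field; lra.
have sg : 1 <= (8 * M%:R ^+ 2) * g.
  rewrite /g mulrCA mulfV ?mulr1; last by rewrite mulf_neq0 ?expf_neq0 //; lra.
  by rewrite expr_ge1 //; lra.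
set P : rat := 2 ^+ (8 * s) => main.
have P0 : 0 <= P by rewrite exprn_ge0.
have G0 : 0 < G := lt_le_trans g0 G_ge.
have x0 : (0 : rat) <= x%:R by [].
have main' : cnt <= x%:R * G^-1 + M%:R ^+ 8 * P * G^-1 ^+ 2.
  have -> : x%:R * G^-1 + M%:R ^+ 8 * P * G^-1 ^+ 2 = (x%:R * G + M%:R ^+ 8 * P) / G ^+ 2.
    by field; lra.
  by rewrite ler_pdivlMr // exprn_gt0.
apply: le_trans main' _.
have iG : G^-1 <= g^-1 by rewrite lef_pV2.
have ig : g^-1 <= 8 * M%:R ^+ 2 by rewrite -[leLHS]mul1r ler_pdivrMr.
have iG0 : 0 <= G^-1 by rewrite invr_ge0 ltW.
apply: lerD; first exact: (ler_wpM2l x0 iG).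
have -> : 64 * M%:R ^+ 12 * P = M%:R ^+ 8 * P * (8 * M%:R ^+ 2) ^+ 2 by ring.
have MP0 : 0 <= M%:R ^+ 8 * P by apply: mulr_ge0 P0; apply: exprn_ge0; lra.
apply: (ler_wpM2l MP0); rewrite !expr2.
by have iG' := le_trans iG ig; apply: ler_pM.
Qed.

End Sieve.

(** * Missed indices and close primes *)

Lemma finite_nat_bounded (S : set nat) : finite_set S ->
  exists B, forall a, S a -> a <= B.
Proof.
move=> /finite_seqP[s ->]; exists (\max_(i <- s) i) => a /= sa.
by rewrite (big_rem a sa) /= leq_maxl.
Qed.

(** If no prime follows [p] within distance [n - 1], then the first multiple of [n]
    from [p] on has the same value of [primepi] as [p], so that value lies in
    [calA n]. *)
Lemma prime_near_missed_index n m r B p : 0 < n ->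
  (forall a, calA n a -> a = r %[mod m] -> a <= B) ->
  prime p -> primepi p = r %[mod m] -> B < primepi p ->
  exists2 h : 'I_n, 0 < h & prime (p + h).
Proof.
move=> n0 AB pP pr Bp; apply/exists_inP; apply: contraLR Bp => /exists_inPn np.
have p0 := prime_gt0 pP.
pose k := (p + n.-1) %/ n.
have := divn_eq (p + n.-1) n; have := ltn_mod (p + n.-1) n; rewrite -/k n0 => mlt de.
have k0 : 0 < k by rewrite /k divn_gt0 //; lia.
have eq_pi : primepi (k * n) = primepi p.
  rewrite -[k * n](subnKC (m := p)); last by lia.
  rewrite primepi_prime_free // => h hj.
  have hn : h < n by lia.
  by apply: (np (Ordinal hn)); case/andP: hj.
rewrite -leqNgt -eq_pi; apply: AB; first by exists k.
by rewrite eq_pi.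
Qed.

Lemma primes_sifted y D h p : prime p -> prime (p + h) -> D <= p -> sifted y D h p.
Proof.
move=> pP qP Dp; apply/forallP => q; apply/implyP => /andP[qpr _].
have qD := ltn_ord q.
by rewrite Euclid_dvdM // !dvdn_prime2 //; lia.
Qed.

Lemma sum_ltn_le B I : \sum_(i < I) (i < B) <= B.
Proof.
suff -> : \sum_(i < I) (i < B) = minn I B by apply: geq_minr.
by elim: I => [|I IH]; [rewrite big_ord0 min0n | rewrite big_ord_recr /= IH; lia].
Qed.

(** The left-hand side bounds from below the number of primes up to [x] whose index
    is congruent to [r]. Apart from those below [D] or of index at most [B], each
    of them is followed by a close prime, and then survives the sieve for some
    shift [h]. *)
Lemma residue_count_le n m r B y D x : 0 < n -> 0 < m ->
  (forall a, calA n a -> a = r %[mod m] -> a <= B) ->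
  primepi x %/ m <= D + B +
    \sum_(h < n | 0 < h) \sum_(N < x.+1) sifted y D h N.
Proof.
move=> n0 m0 AB; apply: leq_trans (sum_residue_lower r _ m0) _.
rewrite -(sum_primepi (fun i => i == r %[mod m])).
have B_le : \sum_(p < x.+1 | prime p) (primepi p <= B) <= B.
  rewrite (sum_primepi (fun i => i <= B : nat)).
  exact: sum_ltn_le.
have D_le : \sum_(p < x.+1 | prime p) (p < D) <= D.
  apply: leq_trans (sum_ltn_le D x.+1); rewrite big_mkcond.
  by apply: leq_sum => p _; case: ifP.
rewrite exchange_big /=.
apply: leq_trans (leq_add (leq_add D_le B_le) (leqnn _)).
rewrite -big_split /= [X in _ <= _ + X](bigID (fun p : 'I_x.+1 => prime p)) /=.
rewrite addnA; apply: leq_trans (leq_addr _ _).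
rewrite -big_split /=; apply: leq_sum => p pP.
have [pr|_] := eqVneq (primepi p %% m) (r %% m); last by [].
have [pD|Dp] := ltnP p D; first by lia.
have [pB|Bp] := leqP (primepi p) B; first by lia.
have [h h0 qP] := prime_near_missed_index n0 AB pP pr Bp.
rewrite (bigD1 h) //= (primes_sifted _ pP qP Dp); lia.
Qed.

(** * The two bounds are incompatible *)

Section Comparison.
Local Open Scope ring_scope.

Lemma primepi_pow_lower s : (0 < s)%N ->
  (2 ^ (12 * s) <= 24 * s * primepi (2 ^ (12 * s)))%N.
Proof.
move=> s0; have e : (12 * s = (12 * s).-1.+1)%N by rewrite prednK // muln_gt0.
have := @primepi_lower (2 ^ (12 * s).-1); rewrite expn_gt0 => /(_ isT).
have -> : ((2 ^ (12 * s).-1).*2 = 2 ^ (12 * s))%N by rewrite -mul2n -expnS -e.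
rewrite -expnM leq_exp2l // => le.
rewrite {1}e expnS; apply: (@leq_trans (2 * (12 * s * primepi (2 ^ (12 * s))))).
  by rewrite leq_mul2l.
by lia.
Qed.

(** With [x = 2^(12 s)] there are at least [x / (24 s)] primes, while the sieve leaves
    [O(x / s^2)] survivors; the sieve error is of order [2^(8 s)], negligible against
    [x]. Together these bound [s]. *)
Lemma parameter_bound (n m B M s q p D S : nat) (X := (2 ^ (4 * s))%N) (x := (2 ^ (12 * s))%N) :
  (0 < s)%N -> (0 < M)%N ->
  (x <= 24 * s * p)%N -> (p < q.+1 * m)%N -> (q <= D + B + S)%N ->
  D = (M * 2 ^ s * (M * 2 ^ s))%N ->
  (S%:R : rat) <= n%:R * (x.+1%:R * (8 * M%:R ^+ 2) / s%:R ^+ 2 + 64 * M%:R ^+ 12 * 2 ^+ (8 * s)) ->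
  (s <= 24 * m * (16 * n * M ^ 2 + (B + 2 + 64 * n) * M ^ 12))%N.
Proof.
move=> s0 M0 xp pq qS DE Sle.
have xX : x = (X ^ 3)%N by rewrite /x /X -expnM; congr (_ ^ _)%N; lia.
have sX : (s ^ 2 <= X)%N.
  apply: (@leq_trans ((2 ^ s) ^ 2)); first by rewrite leq_exp2r // ltnW // ltn_expl.
  by rewrite -expnM leq_exp2l //; lia.
have DX : (D <= M ^ 12 * X ^ 2)%N.
  rewrite DE mulnn expnMn leq_mul ?leq_pexp2l //.
  by rewrite -!expnM leq_exp2l //; lia.
have X0 : (0 < X)%N by rewrite expn_gt0.
have x_le : (x <= 24 * s * m * (1 + D + B + S))%N by nia.
have eX : 2 ^+ (8 * s) = X%:R ^+ 2 :> rat.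
  by rewrite /X natrX -exprM; congr (_ ^+ _); lia.
rewrite {}eX in Sle.
have x0 : (0 < x)%N by rewrite expn_gt0.
clearbody x X.
have sr : (0 : rat) < s%:R by rewrite ltr0n.
have S_le : (s%:R ^+ 2 * S%:R : rat) <= (16 * n * M ^ 2 + 64 * n * M ^ 12)%:R * x%:R.
  apply: le_trans (ler_wpM2l (sqr_ge0 _) Sle) _.
  have -> : s%:R ^+ 2 * (n%:R * (x.+1%:R * (8 * M%:R ^+ 2) / s%:R ^+ 2 + 64 * M%:R ^+ 12 * X%:R ^+ 2))
      = (8 * n * M ^ 2 * x.+1 + 64 * n * M ^ 12 * (s ^ 2 * X ^ 2))%:R :> rat.
    by rewrite natrD !(natrX, natrM); have := lt0r_neq0 sr; move: (x.+1%:R) (s%:R) (M%:R) (n%:R) (X%:R) => a b c d e b0; field.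
  rewrite -natrM ler_nat mulnDl leq_add //.
    by rewrite (_ : 16 * n * M ^ 2 * x = 8 * n * M ^ 2 * (x + x))%N; [rewrite leq_mul // -addn1 leq_add2l | lia].
  by rewrite leq_mul // xX [X in (_ <= X)%N]expnS leq_mul.
have sB : (s ^ 2 * (1 + D + B) <= (B + 2) * M ^ 12 * x)%N.
  apply: (@leq_trans (X * ((B + 2) * M ^ 12 * X ^ 2))); last by rewrite xX expnS; lia.
  rewrite leq_mul //.
  have P1 : (0 < M ^ 12 * X ^ 2)%N by rewrite muln_gt0 !expn_gt0 M0 X0.
  by move: P1 DX; set P := (M ^ 12 * X ^ 2)%N => P1 DX; rewrite -mulnA -/P; nia.
have S_le' : (s ^ 2 * S <= (16 * n * M ^ 2 + 64 * n * M ^ 12) * x)%N.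
  by rewrite -(ler_nat rat) natrM natrX (le_trans S_le) // natrM.
rewrite -(leq_pmul2r x0).
apply: (@leq_trans (24 * m * (s ^ 2 * (1 + D + B) + s ^ 2 * S))).
  apply: leq_trans (leq_mul (leqnn s) x_le) _; rewrite leq_eqVlt; apply/orP; left; apply/eqP; ring.
rewrite -[X in (_ <= X)%N]mulnA leq_mul //.
apply: leq_trans (leq_add sB S_le') _.
rewrite leq_eqVlt; apply/orP; left; apply/eqP; ring.
Qed.

End Comparison.

Local Open Scope classical_set_scope.

Theorem corollary1p1 (n m r : nat) (n_gt0 : 0 < n) (m_gt0 : 0 < m)
    (r_gt0 : 0 < r) :
  infinite_set [set a : nat | calA n a /\ a = r %[mod m]].
Proof.
move=> /finite_nat_bounded[B AB].
have AB' a : calA n a -> a = r %[mod m] -> a <= B by move=> *; apply: AB.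
pose y := n + 6; pose M := y`!.
(* [K] is the bound on [s] given by [parameter_bound], so [s] exceeds it. *)
pose K := 24 * m * (16 * n * M ^ 2 + (B + 2 + 64 * n) * M ^ 12).
pose s := K.+1.
pose D := (M * 2 ^ s) * (M * 2 ^ s).
pose x := 2 ^ (12 * s).
have le_q := residue_count_le y D x n_gt0 m_gt0 AB'.
have s0 : 0 < s by [].
have := parameter_bound (n := n) (B := B) (M := M) s0 (fact_gt0 y) (primepi_pow_lower s0)
  (ltn_ceil (primepi x) m_gt0) le_q (erefl D).
rewrite -/K /s ltnn => /(_ _)/notF; apply.
set C : rat := (_ + _)%R.
apply: (@Order.POrderTheory.le_trans _ _ (\sum_(h < n | (0 < h)%N) C)%R); last first.
  rewrite sumr_const -[(_ *+ _)%R]mulr_natl ler_wpM2r //.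
    apply: addr_ge0.
      by apply: divr_ge0; [apply: mulr_ge0 => //; apply: mulr_ge0 => //; apply: exprn_ge0 | apply: exprn_ge0].
    by apply: mulr_ge0; [apply: mulr_ge0 => //; apply: exprn_ge0 | apply: exprn_ge0].
  by rewrite ler_nat (leq_trans (max_card _)) // card_ord.
rewrite natr_sum; apply: ler_sum => h h0.
have hy : 0 < h <= y by rewrite h0 /y (leq_trans (ltnW (ltn_ord h))) // leq_addr.
apply: Order.POrderTheory.le_trans (sifted_count_le _ hy (leq_addl _ _) s0).
rewrite natr_sum [X in (_ <= X)%R]big_mkcond; apply: ler_sum => N _.
by case: sifted.
Qed.
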